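(* Let $d\ge 1$, $0<\xi\le 1$, $w_1,\dots,w_d>0$, let $\mathcal J$ be a collection of non-empty subsets of $\{1,\dots,d\}$, and let $\boldsymbol c=(c_J)_{J\in\mathcal J}$ be non-negative constants. Let $\mathbb S_+=\{\boldsymbol u\in[0,\infty)^d:\sum_{i=1}^d u_i=1\}$. The upper bound problem $$(\mathcal U_\rho)\qquad \sup_H \int_{\mathbb S_+}\Big(\sum_{i=1}^d w_iu_i^\xi\Big)^{1/\xi}H(d\boldsymbol u)\quad\text{subject to}\quad \int_{\mathbb S_+}\max_{j\in J}u_j\,H(d\boldsymbol u)=c_J,\ J\in\mathcal J,$$ where $H$ ranges over finite (non-negative) Borel measures on $\mathbb S_+$, is the dual of the linear semi-infinite program $$(P)\qquad \inf_{\boldsymbol x\in\mathbb R^{|\mathcal J|}}\boldsymbol c^\top\boldsymbol x\quad\text{subject to}\quad b(t)-\boldsymbol a(t)^\top\boldsymbol x\le 0,\ t\in T,$$ where $T=\mathbb S_+$, $\boldsymbol a(t)=(\max_{j\in J}t_j)_{J\in\mathcal J}$, and $b(t)=\big(\sum_{i=1}^d w_it_i^\xi\big)^{1/\xi}$. Similarly, the lower bound problem $(\mathcal L_\rho)$, obtained from $(\mathcal U_\rho)$ by replacing $\sup_H$ with $\inf_H$, is (after changing the sign of the objective functions) the dual of the linear semi-infinite program involving maximization $$\sup_{\boldsymbol x\in\mathbb R^{|\mathcal J|}}\boldsymbol c^\top\boldsymbol x\quad\text{subject to}\quad \boldsymbol a(t)^\top\boldsymbol x\le b(t),\ t\in T;$$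 that is, the dual of the program $\inf_{\boldsymbol x}\,(-\boldsymbol c)^\top\boldsymbol x$ subject to $-b(t)+\boldsymbol a(t)^\top\boldsymbol x\le0$, $t\in T$, is the problem of maximizing $-\int_{\mathbb S_+} b\,dH$ over finite Borel measures $H$ on $\mathbb S_+$ satisfying the same constraints as in $(\mathcal U_\rho)$.
   Context: Duality for linear semi-infinite programs. Let $T\subset\mathbb R^d$ be compact, $\boldsymbol a:T\to\mathbb R^p$ and $b:T\to\mathbb R$ continuous, $\boldsymbol c\in\mathbb R^p$, and consider the program: minimize $\boldsymbol c^\top\boldsymbol x$ over $\boldsymbol x\in\mathbb R^p$ subject to $b(t)-\boldsymbol a(t)^\top\boldsymbol x\le0$ for all $t\in T$. Let $\Omega$ be the set of finite non-negative Borel measures on $T$. The Lagrangian is $L(\boldsymbol x,\omega)=\boldsymbol c^\top\boldsymbol x+\int_T(b(t)-\boldsymbol a(t)^\top\boldsymbol x)\,\omega(dt)$, for $\boldsymbol x\in\mathbb R^p$, $\omega\in\Omega$, and the dual function is $g(\omega)=\inf_{\boldsymbol x\in\mathbb R^p}L(\boldsymbol x,\omega)$. A measure $\omega\in\Omega$ is dual feasible if $g(\omega)>-\infty$. The dual problem is to maximize $g(\omega)$ over all dual feasible $\omega\in\Omega$. Two problems over $\Omega$ are regarded as the same if they have the same feasible set and the same objective on it. *)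

(* Defs.v *)
From HB Require Import structures.
From mathcomp Require Import all_boot all_order all_algebra.
From mathcomp Require Import all_classical all_reals all_analysis.
Import Order.TTheory GRing.Theory Num.Theory.
Import numFieldNormedType.Exports.

Set Implicit Arguments.
Unset Strict Implicit.
Unset Printing Implicit Defensive.

Local Open Scope classical_set_scope.
Local Open Scope ring_scope.

(** * Optimization problems *)

Inductive opt_sense := Minimize | Maximize.

Record opt_problem (R : realType) (X : Type) := OptProblem {
  sense : opt_sense;
  feasible : set X;
  objective : X -> \bar R }.

(* The objectives only have to agree on the common feasible set. *)
Definition same_problem (R : realType) (X : Type) (p q : opt_problem R X) :=
  [/\ sense p = sense q,
      feasible p = feasible q &
      forall x, feasible p x -> objective p x = objective q x].

Definition opp_sense (s : opt_sense) :=
  match s with Minimize => Maximize | Maximize => Minimize end.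

(* The same problem after changing the sign of its objective function, so that
   minimizing becomes maximizing and conversely. *)
Definition opp_problem (R : realType) (X : Type) (p : opt_problem R X) :=
  OptProblem (opp_sense (sense p)) (feasible p)
             (fun x => (- objective p x)%E).

(** * Finite Borel measures on a subset of R^d *)

Definition borel_rV (R : realType) (d : nat) :=
  g_sigma_algebraType (@open 'rV[R]_d).

(* A finite Borel measure on a Borel set [T] of R^d is represented by its
   extension by zero, i.e. by a finite Borel measure on R^d for which the
   complement of [T] is null.  (Measurable types are pointed in the library, so
   that the possibly empty subtype [T] is not one of them.) *)
Definition Omega (R : realType) (d : nat) (T : set 'rV[R]_d) :
    set {finite_measure set (borel_rV R d) -> \bar R} :=
  [set mu | mu (~` T) = 0%E].

(** * Linear semi-infinite programs and their duals *)

Definition dot (R : realType) (p : nat) (u v : 'rV[R]_p) : R :=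
  \sum_i u 0 i * v 0 i.

(* The values of [lsip_a] and [lsip_b] outside [lsip_T] are never used. *)
Record lsip (R : realType) (d p : nat) := Lsip {
  lsip_T : set 'rV[R]_d;
  lsip_a : 'rV[R]_d -> 'rV[R]_p;
  lsip_b : 'rV[R]_d -> R;
  lsip_c : 'rV[R]_p }.

Definition lsip_wf (R : realType) (d p : nat) (P : lsip R d p) :=
  [/\ compact (lsip_T P),
      {within lsip_T P, continuous (lsip_a P)} &
      {within lsip_T P, continuous (lsip_b P)}].

Definition primal (R : realType) (d p : nat) (P : lsip R d p) :
    opt_problem R 'rV[R]_p :=
  OptProblem Minimize
    [set x | forall t, lsip_T P t -> lsip_b P t - dot (lsip_a P t) x <= 0]
    (fun x => (dot (lsip_c P) x)%:E).

Definition lagrangian (R : realType) (d p : nat) (P : lsip R d p)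
    (x : 'rV[R]_p) (mu : {finite_measure set (borel_rV R d) -> \bar R}) :
    \bar R :=
  ((dot (lsip_c P) x)%:E
   + \int[mu]_(t in lsip_T P) (lsip_b P t - dot (lsip_a P t) x)%:E)%E.

Definition dual_function (R : realType) (d p : nat) (P : lsip R d p)
    (mu : {finite_measure set (borel_rV R d) -> \bar R}) : \bar R :=
  ereal_inf [set lagrangian P x mu | x in [set: 'rV[R]_p]].

Definition dual (R : realType) (d p : nat) (P : lsip R d p) :
    opt_problem R {finite_measure set (borel_rV R d) -> \bar R} :=
  OptProblem Maximize
    [set mu | Omega (lsip_T P) mu /\ (-oo < dual_function P mu)%E]
    (dual_function P).

(** * The two bound problems and the associated semi-infinite programs *)

Definition simplex (R : realType) (d : nat) : set 'rV[R]_d :=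
  [set u | (forall i, 0 <= u 0 i) /\ \sum_i u 0 i = 1].

(* On vectors with non-negative entries, and for non-empty [J], the default
   value 0 has no effect. *)
Definition max_on (R : realType) (d : nat) (J : {set 'I_d}) (u : 'rV[R]_d) : R :=
  \big[Num.max/0]_(j in J) u 0 j.

Definition obj_fun (R : realType) (d : nat) (xi : R) (w : 'I_d -> R)
    (u : 'rV[R]_d) : R :=
  (\sum_i w i * u 0 i `^ xi) `^ xi^-1.

Definition moment_feasible (R : realType) (d : nat) (JJ : {set {set 'I_d}})
    (c : {set 'I_d} -> R) :
    set {finite_measure set (borel_rV R d) -> \bar R} :=
  [set H | Omega (@simplex R d) H /\
    forall J, J \in JJ ->
      (\int[H]_(u in @simplex R d) (max_on J u)%:E = (c J)%:E)%E].

Definition upper_problem (R : realType) (d : nat) (xi : R) (w : 'I_d -> R)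
    (JJ : {set {set 'I_d}}) (c : {set 'I_d} -> R) :
    opt_problem R {finite_measure set (borel_rV R d) -> \bar R} :=
  OptProblem Maximize (moment_feasible JJ c)
    (fun H => \int[H]_(u in @simplex R d) (obj_fun xi w u)%:E)%E.

Definition lower_problem (R : realType) (d : nat) (xi : R) (w : 'I_d -> R)
    (JJ : {set {set 'I_d}}) (c : {set 'I_d} -> R) :
    opt_problem R {finite_measure set (borel_rV R d) -> \bar R} :=
  OptProblem Minimize (moment_feasible JJ c)
    (fun H => \int[H]_(u in @simplex R d) (obj_fun xi w u)%:E)%E.

(* Vectors indexed by the collection [JJ] are row vectors of length [#|JJ|]
   through the enumeration [enum_val] of [JJ]. *)
Definition max_vec (R : realType) (d : nat) (JJ : {set {set 'I_d}})
    (t : 'rV[R]_d) : 'rV[R]_#|JJ| :=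
  \row_(k < #|JJ|) max_on (enum_val k) t.

Definition const_vec (R : realType) (d : nat) (JJ : {set {set 'I_d}})
    (c : {set 'I_d} -> R) : 'rV[R]_#|JJ| :=
  \row_(k < #|JJ|) c (enum_val k).

Definition upper_lsip (R : realType) (d : nat) (xi : R) (w : 'I_d -> R)
    (JJ : {set {set 'I_d}}) (c : {set 'I_d} -> R) : lsip R d #|JJ| :=
  Lsip (@simplex R d) (max_vec JJ) (obj_fun xi w) (const_vec JJ c).

Definition lower_max_program (R : realType) (d : nat) (xi : R) (w : 'I_d -> R)
    (JJ : {set {set 'I_d}}) (c : {set 'I_d} -> R) :
    opt_problem R 'rV[R]_#|JJ| :=
  OptProblem Maximize
    [set x | forall t, simplex t -> dot (max_vec JJ t) x <= obj_fun xi w t]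
    (fun x => (dot (const_vec JJ c) x)%:E).

Definition lower_lsip (R : realType) (d : nat) (xi : R) (w : 'I_d -> R)
    (JJ : {set {set 'I_d}}) (c : {set 'I_d} -> R) : lsip R d #|JJ| :=
  Lsip (@simplex R d) (fun t => - max_vec JJ t) (fun t => - obj_fun xi w t)
       (- const_vec JJ c).

(* Main.v *)
Require Import Defs.
From mathcomp Require Import all_boot all_order all_algebra.
From mathcomp Require Import all_classical all_reals all_analysis.
Import Order.TTheory GRing.Theory Num.Theory.
Import numFieldNormedType.Exports.
Local Open Scope classical_set_scope.
Local Open Scope ring_scope.

(* Since b and the coordinates of a are integrable for every finite measure on
   the compact set T, the Lagrangian is the affine function of x
     L(x, mu) = \int b dmu + \sum_k (c_k - \int a_k dmu) x_k.
   Its infimum over all x is \int b dmu if every linear coefficient vanishes,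
   i.e. if mu satisfies the moment constraints, and -oo otherwise. *)

(** * Borel measurability and integrability on compact sets *)

(** It suffices to test open intervals, which generate the Borel sets of the line. Continuity within
    [D] makes each preimage the trace on [D] of an open set. *)
Lemma measurable_fun_borel_rV (R : realType) (d : nat) (D : set 'rV[R]_d)
    (f : 'rV[R]_d -> R) :
  measurable (D : set (borel_rV R d)) -> {within D, continuous f} ->
  measurable_fun (D : set (borel_rV R d)) (f : borel_rV R d -> R).
Proof.
move=> mD /continuousP cf.
apply: (measurability _ (measurable_realfun.RGenOpens.measurableE R)).
move=> _ [_ [a [b ->] <-]].
have /open_subspaceP[V oV VD] :=
  cf _ (@interval_open _ (BRight a) (BLeft b) isT isT).
rewrite setIC -VD; apply: measurableI => //.
exact: sub_sigma_algebra.
Qed.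

Lemma measurable_compact_borel_rV (R : realType) (d : nat) (D : set 'rV[R]_d) :
  compact D -> measurable (D : set (borel_rV R d)).
Proof.
move=> /compact_closed cD; rewrite -[D]setCK; apply: measurableC.
apply: sub_sigma_algebra; apply: closed_openC; apply: cD.
exact: norm_hausdorff.
Qed.

(** A continuous function is bounded on a compact set, and [mu D] is finite. *)
Lemma integrable_borel_rV (R : realType) (d : nat) (D : set 'rV[R]_d)
    (f : 'rV[R]_d -> R)
    (mu : {finite_measure set (borel_rV R d) -> \bar R}) :
  compact D -> {within D, continuous f} ->
  mu.-integrable (D : set (borel_rV R d)) (EFin \o (f : borel_rV R d -> R)).
Proof.
move=> cD cf; have mD := measurable_compact_borel_rV _ _ _ cD.
apply: measurable_bounded_integrable => //.
- by rewrite ltey_eq fin_num_measure.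
- exact: measurable_fun_borel_rV.
- have /compact_bounded[M [_ hM]] := continuous_compact cf cD.
  by exists M; split; rewrite ?num_real // => ? ? ? ?; exact: hM.
Qed.

(** * Well-posedness of the data: continuity and the compact simplex *)

(** To the left of 0 the function is locally constant, to the right it agrees locally with a
    differentiable power, and at 0 an epsilon estimate is made. *)
Lemma continuous_powR_max0 (R : realType) (p : R) : 0 < p ->
  continuous (fun x : R => Num.max x 0 `^ p).
Proof.
move=> p0 x; rewrite /continuous_at; have [x0|x0|->] := ltgtP x 0.
- apply: cvg_near_cst.
  near=> y; rewrite max_r//; apply: ltW; near: y; exact: lt_nbhsl.
- have powx : {for x, continuous (fun y : R => y `^ p)}.
    apply: differentiable_continuous; apply/derivable1_diffP.
    by apply: derivable_powR; rewrite in_itv/= x0.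
  apply: cvg_trans powx; apply: near_eq_cvg.
  near=> y; rewrite max_l//; apply: ltW; near: y; exact: lt_nbhsr.
- rewrite powR0 ?gt_eqF//; apply/cvgr0Pnorm_lt => e e0.
  near=> y; rewrite ger0_norm ?powR_ge0//.
  (* With [e] written as a [p]-th power, strict monotonicity of the power reduces the bound to one
     on [y] itself. *)
  have {1}-> : e = (e `^ p^-1) `^ p.
    by rewrite -powRrM mulVf ?powRr1 ?ltW ?gt_eqF.
  apply: gt0_ltr_powR; rewrite ?nnegrE ?powR_ge0 ?le_max ?lexx ?orbT//.
  rewrite gt_max powR_gt0// andbT.
  by near: y; apply: lt_nbhsl; rewrite powR_gt0.
Unshelve. all: by end_near. Qed.

(** Neighbourhoods of a row vector are given entrywise, and finitely many entries impose finitely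
    many conditions. *)
Lemma continuous_row (T : topologicalType) (R : realType) (p : nat)
    (f : 'I_p -> T -> R) :
  (forall k, continuous (f k)) ->
  continuous (fun t => \row_k f k t : 'rV[R]_p).
Proof.
move=> cf t A [P Pnbhs PA].
have : \forall s \near t, forall k, P 0 k (f k s).
  by apply: filter_forall => k; apply: cf; have := Pnbhs 0 k; rewrite mxE.
by apply: filterS => s Ps; apply: PA => i k; rewrite ord1 mxE.
Qed.

Lemma continuous_max_on (R : realType) (d : nat) (J : {set 'I_d}) :
  continuous (@max_on R d J).
Proof.
apply: continuous_big => [|i _]; last exact: coord_continuous.
move=> x; apply: continuous_max; [exact: cvg_fst|exact: cvg_snd].
Qed.

Lemma continuous_sum_coord (R : realType) (d : nat) :
  continuous (fun u : 'rV[R]_d => \sum_i u 0 i).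
Proof.
apply: continuous_big => [|i _]; last exact: coord_continuous.
exact: add_continuous.
Qed.

(** Bounded, since each entry is at most the sum of all the non-negative entries, which is 1;
    closed, as an intersection of preimages of closed sets. *)
Lemma compact_simplex (R : realType) (d : nat) : compact (@simplex R d).
Proof.
apply: bounded_closed_compact.
  exists 1; split; rewrite ?num_real// => M M1 u [u0 u1].
  rewrite /Num.norm/= mx_normrE; apply: bigmax_le => [|[i j] _ /=].
    by rewrite (le_trans ler01)// ltW.
  rewrite ord1 ger0_norm ?u0// (le_trans _ (ltW M1))// -u1 (bigD1 j)//=.
  by rewrite lerDl sumr_ge0.
rewrite (_ : @simplex R d = (\bigcap_(i in [set: 'I_d])
    ((fun u : 'rV[R]_d => u 0 i) @^-1` [set x | 0 <= x])) `&`
    ((fun u : 'rV[R]_d => \sum_i u 0 i) @^-1` [set 1])); last first.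
  apply/seteqP; split=> u [u0 u1]; split=> //.
    by move=> i _; exact: u0.
  by move=> i; exact: (u0 i I).
apply: closedI.
  apply: closed_bigI => i _; apply: closed_comp; last exact: closed_ge.
  by move=> u _; exact: coord_continuous.
apply: closed_comp; last exact: closed_eq.
by move=> u _; exact: continuous_sum_coord.
Qed.

(* Off the simplex [powR] may jump ([a `^ p = 1] for [a < 0]); truncating at 0
   gives a globally continuous function with the same values on the simplex. *)
Lemma within_continuous_obj_fun (R : realType) (d : nat) (xi : R)
    (w : 'I_d -> R) : 0 < xi -> (forall i, 0 <= w i) ->
  {within @simplex R d, continuous (obj_fun xi w)}.
Proof.
move=> xi0 w0.
pose f (u : 'rV[R]_d) :=
  Num.max (\sum_i w i * Num.max (u 0 i) 0 `^ xi) 0 `^ xi^-1.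
apply: (@subspace_eq_continuous _ _ _ f).
  move=> u; rewrite inE => -[u0 _]; rewrite /f /obj_fun max_l.
    by congr (_ `^ _); apply: eq_bigr => i _; rewrite max_l.
  by apply: sumr_ge0 => i _; rewrite mulr_ge0// powR_ge0.
apply: continuous_subspaceT => u.
apply: (@continuous_comp _ _ _ (fun u : 'rV[R]_d =>
   \sum_i w i * Num.max (u 0 i) 0 `^ xi) (fun x => Num.max x 0 `^ xi^-1)).
  apply: continuous_big; first exact: add_continuous.
  move=> i _ v; apply: (@continuous_comp _ _ _ (fun u : 'rV[R]_d => u 0 i)
    (fun x => w i * Num.max x 0 `^ xi)); first exact: coord_continuous.
  by apply: cvgM; [exact: cvg_cst|exact: continuous_powR_max0].
by apply: continuous_powR_max0; rewrite invr_gt0.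
Qed.

Lemma within_continuousN (T : topologicalType) (R : realType) (D : set T)
    (V : normedModType R) (f : T -> V) :
  {within D, continuous f} -> {within D, continuous (fun t => - f t)}.
Proof. by move=> cf t; apply: cvgN; exact: cf. Qed.

(** * The dual function of a general program *)

Section duality.
Context {R : realType} {d p : nat} {P : lsip R d p}.
Variable mu : {finite_measure set (borel_rV R d) -> \bar R}.
Hypothesis Pwf : lsip_wf P.
Local Open Scope ereal_scope.

(** The type ascription makes measurability of [T] refer to the Borel sigma-algebra. *)
Let T : set (borel_rV R d) := lsip_T P.

Let mT : measurable T.
Proof. by case: Pwf => cT _ _; exact: measurable_compact_borel_rV. Qed.

Lemma integrable_lsip_b : mu.-integrable T (fun t => (lsip_b P t)%:E).
Proof. by case: Pwf => cT _ cb; exact: integrable_borel_rV. Qed.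

Lemma integrable_lsip_a k : mu.-integrable T (fun t => (lsip_a P t ord0 k)%:E).
Proof.
case: Pwf => cT ca _.
apply: (integrable_borel_rV _ _ _ (fun t => lsip_a P t ord0 k)) => //.
move=> t; apply: (@continuous_comp _ _ _ (lsip_a P : subspace _ -> _)
  (fun u : 'rV[R]_p => u ord0 k)); first exact: ca.
exact: coord_continuous.
Qed.

(** All integrals involved are finite, so linearity applies and [fine] loses nothing. *)
Lemma lagrangianE x : lagrangian P x mu =
  \int[mu]_(t in T) (lsip_b P t)%:E +
  (\sum_k (lsip_c P ord0 k - fine (\int[mu]_(t in T) (lsip_a P t ord0 k)%:E))
     * x ord0 k)%:E.
Proof.
have iax k : mu.-integrable T (fun t => (x ord0 k)%:E * (lsip_a P t ord0 k)%:E).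
  by apply: integrableZl => //; exact: integrable_lsip_a.
rewrite /lagrangian.
have -> : \int[mu]_(t in T) (lsip_b P t - dot (lsip_a P t) x)%:E =
    \int[mu]_(t in T) (lsip_b P t)%:E - \sum_k
      ((x ord0 k)%:E * \int[mu]_(t in T) (lsip_a P t ord0 k)%:E).
  (* The right-hand side is folded back into a single integral: first the scalars, then the finite
     sum, then the difference. *)
  rewrite -[in RHS](eq_bigr _
    (fun k _ => integralZl mT (integrable_lsip_a k) _)).
  rewrite -integral_sum// -integralB//; last exact: integrable_sum.
    apply: eq_integral => t _; rewrite EFinB; congr (_ - _)%E.
    by rewrite /dot sumEFin; congr _%:E; apply: eq_bigr => k _; rewrite mulrC.
  exact: integrable_lsip_b.
have -> : \sum_k ((x ord0 k)%:E * \int[mu]_(t in T) (lsip_a P t ord0 k)%:E) =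
    (\sum_k fine (\int[mu]_(t in T) (lsip_a P t ord0 k)%:E) * x ord0 k)%:E.
  rewrite -sumEFin; apply: eq_bigr => k _; rewrite EFinM fineK 1?muleC//.
  by apply: integrable_fin_num => //; exact: integrable_lsip_a.
rewrite addeCA -EFinN -EFinD /dot; congr (_ + _%:E).
by rewrite -sumrN -big_split/=; apply: eq_bigr => k _; rewrite mulrBl.
Qed.

Lemma dual_functionE :
  (forall k, \int[mu]_(t in T) (lsip_a P t ord0 k)%:E = (lsip_c P ord0 k)%:E) ->
  dual_function P mu = \int[mu]_(t in T) (lsip_b P t)%:E.
Proof.
move=> ac; rewrite /dual_function.
have -> : [set lagrangian P x mu | x in [set: 'rV[R]_p]] =
    [set \int[mu]_(t in T) (lsip_b P t)%:E]; last exact: ereal_inf1.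
have Lx x : lagrangian P x mu = \int[mu]_(t in T) (lsip_b P t)%:E.
  rewrite lagrangianE big1 ?adde0// => k _.
  by rewrite ac/= subrr mul0r.
apply/seteqP; split=> [_ [x _ <-]|_ ->]; first exact: Lx.
(* Every [x] gives this value; 0 serves as a witness. *)
by exists 0%R.
Qed.

(* If the k-th moment constraint fails, the Lagrangian is affine and
   non-constant along the k-th coordinate axis, hence unbounded below. *)
Lemma dual_function_gtNy :
  -oo < dual_function P mu <->
  forall k, \int[mu]_(t in T) (lsip_a P t ord0 k)%:E = (lsip_c P ord0 k)%:E.
Proof.
split=> [+ k|ac]; last first.
  rewrite dual_functionE// ltNye_eq; apply/orP; left.
  by apply: integrable_fin_num => //; exact: integrable_lsip_b.
have Bfin : \int[mu]_(t in T) (lsip_b P t)%:E \is a fin_num.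
  by apply: integrable_fin_num => //; exact: integrable_lsip_b.
have Afin : \int[mu]_(t in T) (lsip_a P t ord0 k)%:E \is a fin_num.
  by apply: integrable_fin_num => //; exact: integrable_lsip_a.
set A := \int[mu]_(t in T) (lsip_a P t ord0 k)%:E in Afin *.
set B := \int[mu]_(t in T) (lsip_b P t)%:E in Bfin *.
move=> g_gtNy; apply: contrapT => Ac; pose a := (lsip_c P ord0 k - fine A)%R.
have a0 : a != 0%R.
  by rewrite subr_eq0; apply: contra_notN Ac => /eqP ->; rewrite fineK.
have gL x : dual_function P mu <= lagrangian P x mu.
  by apply: ereal_inf_lbound; exists x.
(* Bounded below by assumption, and above by the finite value of the Lagrangian at 0. *)
have gfin : dual_function P mu \is a fin_num.
  rewrite fin_numE gt_eqF//= lt_eqF// (le_lt_trans (gL 0%R))// lagrangianE.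
  by rewrite lte_add_pinfty ?ltry// ltey_eq Bfin.
(* Chosen to solve [B + a * y = g - 1], where [g] is the dual function at [mu]: at [y] times the
   [k]-th unit vector the Lagrangian would lie below its own infimum. *)
pose y := ((fine (dual_function P mu) - 1 - fine B) / a)%R.
have := gL (\row_j (y *+ (j == k)))%R.
rewrite lagrangianE (bigD1 k)//= big1 => [|j jk]; last first.
  by rewrite mxE (negbTE jk) mulr0.
rewrite mxE eqxx mulr1n addr0 -/a /y mulrC divfK// -/B.
rewrite -(fineK Bfin) -(fineK gfin) -EFinD lee_fin/=.
by rewrite addrC subrK lerDl oppr_ge0 ler10.
Qed.
End duality.

(** * The upper and lower bound problems *)

Lemma dotNl (R : realType) (p : nat) (u v : 'rV[R]_p) : dot (- u) v = - dot u v.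
Proof. by rewrite /dot -sumrN; apply: eq_bigr => k _; rewrite mxE mulNr. Qed.

Lemma lsip_wf_opp (R : realType) (d p : nat) (T : set 'rV[R]_d)
    (a : 'rV[R]_d -> 'rV[R]_p) (b : 'rV[R]_d -> R) (c : 'rV[R]_p) :
  lsip_wf (Lsip T a b c) ->
  lsip_wf (Lsip T (fun t => - a t) (fun t => - b t) (- c)).
Proof. by case=> cT ca cb; split=> //; exact: within_continuousN. Qed.

Lemma upper_lsip_wf (R : realType) (d : nat) (xi : R) (w : 'I_d -> R)
    (JJ : {set {set 'I_d}}) (c : {set 'I_d} -> R) :
  0 < xi -> (forall i, 0 <= w i) -> lsip_wf (upper_lsip xi w JJ c).
Proof.
move=> xi0 w0; split=> /=; first exact: compact_simplex.
- apply: continuous_subspaceT; apply: continuous_row => k.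
  exact: continuous_max_on.
- exact: within_continuous_obj_fun.
Qed.

(** Translates constraints indexed by the sets in [JJ] into constraints indexed by positions in the
    enumeration of [JJ]. *)
Lemma moment_feasibleP (R : realType) (d : nat) (JJ : {set {set 'I_d}})
    (c : {set 'I_d} -> R) (mu : {finite_measure set (borel_rV R d) -> \bar R}) :
  moment_feasible JJ c mu <-> Omega (@simplex R d) mu /\
    forall k, (\int[mu]_(t in @simplex R d) (max_vec JJ t ord0 k)%:E =
               (const_vec JJ c ord0 k)%:E)%E.
Proof.
split=> -[muS muc]; split=> //.
  by move=> k; rewrite mxE -muc ?enum_valP//; apply: eq_integral => t _;
    rewrite mxE.
move=> J JJJ; have := muc (enum_rank_in JJJ J).
rewrite mxE enum_rankK_in// => <-.
by apply: eq_integral => t _; rewrite mxE enum_rankK_in.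
Qed.

Theorem corollary2p6 (R : realType) (d : nat) (hd : (1 <= d)%N)
    (xi : R) (hxi0 : 0 < xi) (hxi1 : xi <= 1)
    (w : 'I_d -> R) (hw : forall i, 0 < w i)
    (JJ : {set {set 'I_d}}) (hJJ : forall J, J \in JJ -> J != finset.set0)
    (c : {set 'I_d} -> R) (hc : forall J, J \in JJ -> 0 <= c J) :
  [/\ lsip_wf (upper_lsip xi w JJ c)
    & same_problem (dual (upper_lsip xi w JJ c)) (upper_problem xi w JJ c)] /\
  [/\ lsip_wf (lower_lsip xi w JJ c),
      same_problem (primal (lower_lsip xi w JJ c))
                   (opp_problem (lower_max_program xi w JJ c))
    & same_problem (dual (lower_lsip xi w JJ c))
                   (opp_problem (lower_problem xi w JJ c))].
Proof.
have wfU : lsip_wf (upper_lsip xi w JJ c).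
  by apply: upper_lsip_wf => // i; exact: ltW.
have wfL : lsip_wf (lower_lsip xi w JJ c).
  (* By conversion, [lower_lsip] is [upper_lsip] with [a], [b] and [c] negated. *)
  exact: (lsip_wf_opp _ _ _ _ _ _ _ wfU).
have mS : measurable (@simplex R d : set (borel_rV R d)).
  by apply: measurable_compact_borel_rV; exact: compact_simplex.
(* Negating both sides of every moment constraint leaves the feasible measures unchanged. *)
have oppN (mu : {finite_measure set (borel_rV R d) -> \bar R}) :
    (forall k, \int[mu]_(t in @simplex R d)
      ((- max_vec JJ t) ord0 k)%:E = ((- const_vec JJ c) ord0 k)%:E)%E <->
    (forall k, \int[mu]_(t in @simplex R d) (max_vec JJ t ord0 k)%:E =
      (const_vec JJ c ord0 k)%:E)%E.
  have intN k : (\int[mu]_(t in @simplex R d) ((- max_vec JJ t) ord0 k)%:E =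
      - \int[mu]_(t in @simplex R d) (max_vec JJ t ord0 k)%:E)%E.
    (* Integrability excludes the indeterminate form in which both the positive and the negative
       part have infinite integral. *)
    rewrite -integralN; last first.
      by apply: integrable_add_def => //; exact: (integrable_lsip_a mu wfU k).
    by apply: eq_integral => t _; rewrite mxE EFinN.
  split=> muc k.
    by apply: oppe_inj; rewrite -intN muc [in LHS]mxE.
  by rewrite intN muc [in RHS]mxE.
have feasU : feasible (dual (upper_lsip xi w JJ c)) = moment_feasible JJ c.
  apply/seteqP; split=> mu.
    by move=> [muS /(dual_function_gtNy _ wfU) muc]; exact/moment_feasibleP.
  move=> /moment_feasibleP[muS muc]; split=> //.
  exact/(dual_function_gtNy _ wfU).
have feasL : feasible (dual (lower_lsip xi w JJ c)) = moment_feasible JJ c.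
  apply/seteqP; split=> mu.
    move=> [muS /(dual_function_gtNy _ wfL) muc]; apply/moment_feasibleP.
    by split=> //; exact/oppN.
  move=> /moment_feasibleP[muS /oppN muc]; split=> //.
  exact/(dual_function_gtNy _ wfL).
(* There remain the upper dual objective, then for the lower program the primal feasible sets, the
   primal objectives and the dual objectives. *)
split; split=> //; split=> //=.
- move=> mu [_ /(dual_function_gtNy _ wfU) muc]; exact: dual_functionE.
- by apply/seteqP; split=> x xP t /xP /=; rewrite dotNl opprK addrC subr_le0.
- by move=> x _; rewrite dotNl EFinN.
- move=> mu [_ /(dual_function_gtNy _ wfL) muc]; rewrite dual_functionE//.
  rewrite -integralN; last first.
    by apply: integrable_add_def => //; exact: (integrable_lsip_b mu wfU).
  by apply: eq_integral => t _; rewrite EFinN.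
Qed.
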